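(* Let $K=\mathbb{F}_q$ be a finite field with $q\neq 2$. Let $G$ be a connected bipartite graph with bipartition $(V_1,V_2)$ and let $X$ be the projective algebraic toric set parameterized by the edges of $G$ (defined in the context). Then $$\delta_{X_1}(d)\,\delta_{X_2}(d)\leq \delta_{X}(d)\leq \delta_{X_3}(d)\quad\mbox{for all } d\geq 1,$$ where $X_3$ is the projective torus in $\mathbb{P}^{|V_1|+|V_2|-2}$ and $X_i$ is the projective torus in $\mathbb{P}^{|V_i|-1}$ for $i=1,2$.
   Context: Graphs are finite and simple. Let $G$ have vertex set $\{y_1,\ldots,y_n\}$ and edges $f_1,\ldots,f_s$ ($s\geq 1$), and let $v_i=e_j+e_k\in\{0,1\}^n$ be the characteristic vector of $f_i=\{y_j,y_k\}$. Put $K^*=K\setminus\{0\}$ and, for $x\in (K^* )^n$, $x^{v_i}=x_1^{v_{i1}}\cdots x_n^{v_{in}}$. The projective algebraic toric set parameterized by the edges of $G$ is $X=\{[(x^{v_1},\ldots,x^{v_s})] : x\in (K^* )^n\}\subset\mathbb{P}^{s-1}$, the projective space over $K$. A bipartition $(V_1,V_2)$ of $G$ is a partition of the vertex set into two disjoint subsets such that every edge has one end in each. The projective torus in $\mathbb{P}^{m-1}$ is $\{[(x_1,\ldots,x_m)] : x_i\in K^*\mbox{ for all } i\}$. For a set $Z=\{[P_1],\ldots,[P_r]\}\subset\mathbb{P}^{m-1}$ of $r$ distinct points with all coordinates nonzero, and $d\geq 1$, the parameterized projective code $C_Z(d)$ of degree $d$ on $Z$ is the image of the linear map $K[t_1,\ldots,t_m]_d\to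 K^{r}$, $f\mapsto\left(f(P_1)/f_0(P_1),\ldots,f(P_r)/f_0(P_r)\right)$, where $f_0=t_1^d$. Its minimum distance is $\delta_Z(d)=\min\{\|v\| : 0\neq v\in C_Z(d)\}$, where $\|v\|$ is the number of nonzero entries of $v$. *)

(* Defs.v *)
From HB Require Import structures.
From mathcomp Require Import all_boot all_order all_algebra all_field.
From mathcomp Require Import mpoly.

Set Implicit Arguments.
Unset Strict Implicit.
Unset Printing Implicit Defensive.

Import GRing.Theory.
Local Open Scope ring_scope.

(* Throughout, N is a projective dimension: P^N has N.+1 homogeneous
   coordinates, numbered from ord0, so that t_1 is 'X_ord0. *)

Section ProjectiveCodes.

Variable K : finFieldType.

(* The point [v] of P^N, for v != 0, is its set of nonzero multiples. *)
Definition ppoint N (v : 'rV[K]_N.+1) : {set 'rV[K]_N.+1} :=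
  [set c *: v | c : K & c != 0].

Definition prep N (P : {set 'rV[K]_N.+1}) : 'rV[K]_N.+1 :=
  odflt 0 [pick v in P].

Lemma prep_ppoint N (v : 'rV[K]_N.+1) :
  exists2 c : K, c != 0 & prep (ppoint v) = c *: v.
Proof.
rewrite /prep; case: pickP => [w /imsetP[c] | /(_ v)/negP[]].
  by rewrite inE => c0 ->; exists c.
by apply/imsetP; exists 1; rewrite ?scale1r // inE oner_eq0.
Qed.

Definition normalized_eval N d (p : {mpoly K[N.+1]}) (v : 'rV[K]_N.+1) : K :=
  p.@[v ord0] / ('X_ord0 ^+ d : {mpoly K[N.+1]}).@[v ord0].

(* Normalized evaluation of a form does not depend on the representative. *)
Lemma normalized_evalZ N d (p : {mpoly K[N.+1]}) (c : K) (v : 'rV[K]_N.+1) :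
  p \is d.-homog -> c != 0 ->
  normalized_eval d p (c *: v) = normalized_eval d p v.
Proof.
move=> hp c0; rewrite /normalized_eval.
have hom (q : {mpoly K[N.+1]}) : q \is d.-homog ->
    q.@[(c *: v) ord0] = c ^+ d * q.@[v ord0].
  move=> /dhomogP hq; rewrite !mevalE mulr_sumr big_seq [RHS]big_seq.
  apply: eq_bigr => m /hq <-; rewrite mulrCA; congr (_ * _); rewrite /= (mdegE m).
  rewrite -prodrXr -big_split; apply: eq_bigr => i _.
  by rewrite mxE exprMn.
rewrite (hom _ hp) hom; first by rewrite -mulf_div divff ?mul1r // expf_neq0.
by rewrite -[d in d.-homog]mul1n dhomogMn // dhomogX; apply/eqP; exact: mdeg1.
Qed.

Variables (N : nat) (Z : {set {set 'rV[K]_N.+1}}) (d : nat).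

Definition codeword (p : dhomog N.+1 K d) : 'rV[K]_#|Z| :=
  \row_i normalized_eval d p (prep (enum_val i)).

Lemma codeword_is_linear : linear codeword.
Proof.
move=> a p q; apply/rowP=> i; rewrite !mxE /normalized_eval !linearP /=.
by rewrite mulrDl mulrA.
Qed.

HB.instance Definition _ :=
  GRing.isLinear.Build K (dhomog N.+1 K d) 'rV[K]_#|Z| _ codeword
    codeword_is_linear.

Definition pcode : {vspace 'rV[K]_#|Z|} := limg (linfun codeword).

Definition hweight r (v : 'rV[K]_r) : nat := #|[set i | v ord0 i != 0]|.

(* The default value #|Z| bounds every weight, hence does not affect the
   minimum, which ranges over a nonempty set as soon as Z is a nonempty set of
   points with nonzero first coordinate (the form t_1^d maps to (1, .., 1)). *)
Definition min_distance : nat :=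
  \big[minn/#|Z|]_(v in pcode | v != 0) hweight v.

End ProjectiveCodes.

Definition affine_torus (K : finFieldType) n : {set 'rV[K]_n} :=
  [set x : 'rV[K]_n | [forall i, x ord0 i != 0]].

Definition projective_torus (K : finFieldType) N : {set {set 'rV[K]_N.+1}} :=
  [set ppoint x | x in affine_torus K N.+1].

Definition graph_edges n (e : rel 'I_n) : {set {set 'I_n}} :=
  [set [set p.1; p.2] | p : 'I_n * 'I_n & e p.1 p.2].

Definition char_vector n (A : {set 'I_n}) : 'rV[nat]_n :=
  \row_j nat_of_bool (j \in A).

Definition monomial (K : finFieldType) n (v : 'rV[nat]_n) (x : 'rV[K]_n) : K :=
  \prod_(j < n) x ord0 j ^+ v ord0 j.

Definition edge_toric_set (K : finFieldType) n s (f : 'I_s.+1 -> {set 'I_n}) :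
    {set {set 'rV[K]_s.+1}} :=
  [set ppoint (\row_i monomial (char_vector (f i)) x) | x in affine_torus K n].

Definition bipartition n (e : rel 'I_n) (V1 V2 : {set 'I_n}) : Prop :=
  [/\ V1 :|: V2 = setT, [disjoint V1 & V2] &
      forall j k, e j k ->
        (j \in V1) && (k \in V2) || (j \in V2) && (k \in V1)].

(* Main.v *)
(* Write points of X as [(x_j y_k)], jk an edge, with x indexed by V1 and y by V2.
   Lower bound: as G is connected, a point of X determines [x] and [y], so the
   number of nonzeros of a form F on X is at least the number of pairs ([x], [y])
   at which the bihomogeneous pullback of F does not vanish. If it does not vanish
   at ([x0], [y0]), the form F(., y0) has at least delta_{X1} nonzeros [x], and for
   each of them F(x, .) has at least delta_{X2} nonzeros.
   Upper bound: keeping only the coordinates of a spanning tree, which has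
   |V1| + |V2| - 1 edges, maps X bijectively onto X3, so forms on X3 pull back to
   forms on X with the same number of nonzeros. *)

Require Import Defs.
(* [mpoly] comes first because its [symmetric] shadows the one on relations. *)
From mathcomp Require Import mpoly.
From mathcomp Require Import all_boot all_order all_algebra all_field.

Set Implicit Arguments.
Unset Strict Implicit.
Unset Printing Implicit Defensive.

Import GRing.Theory.

(** * Cardinalities of images and fibres *)

Section FiniteImages.

(** On [A] the map [f] factors through [g], so [f @: A] is an image of [g @: A]. *)
Lemma leq_card_imset_ker (T : finType) (U W : finType) (f : T -> U)
    (g : T -> W) (A : {set T}) :
    {in A &, forall x y, g x = g y -> f x = f y} ->
  #|f @: A| <= #|g @: A|.
Proof.
move=> fg; have [-> | /set0Pn[x0 _]] := eqVneq A set0; first by rewrite !imset0 !cards0.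
pose h w := f (odflt x0 [pick x in A | g x == w]).
suff /subset_leq_card le : f @: A \subset h @: (g @: A).
  exact: leq_trans le (leq_imset_card _ _).
apply/subsetP=> _ /imsetP[x xA ->]; apply/imsetP; exists (g x).
  exact: imset_f.
rewrite /h; case: pickP => [y /andP[yA /eqP gy] | /(_ x)].
  by apply: fg => //; rewrite gy.
by rewrite xA eqxx.
Qed.

(** The size is a separate [m] so that the index type can take the successor form of projective
    coordinates. *)
Lemma card_enum_inj (T : finType) (A : {set T}) (m : nat) :
  #|A| = m -> exists2 g : 'I_m -> T, injective g & forall x, x \in A <-> exists i, x = g i.
Proof.
move=> <-; exists enum_val; first exact: enum_val_inj.
move=> x; split=> [xA | [i ->]]; last exact: enum_valP.
by exists (enum_rank_in xA x); rewrite enum_rankK_in.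
Qed.

Lemma leq_card_pair_fibers (U W : finType) (S : {set U * W}) (A : {set U})
    (m : nat) :
    (forall u, u \in A -> m <= #|[set w | (u, w) \in S]|) ->
  #|A| * m <= #|S|.
Proof.
move=> hm; rewrite -sum_nat_const.
apply: (@leq_trans (\sum_(u in A) #|[set w | (u, w) \in S]|)%N).
  exact: leq_sum.
rewrite -[leqRHS]sum1_card (partition_big fst predT) //=.
rewrite [leqRHS](bigID (mem A)) /=; apply: leq_trans (leq_addr _ _).
apply: leq_sum => u _; rewrite sum1dep_card.
rewrite -(card_imset [set w | (u, w) \in S] (_ : injective (pair u))).
  apply/subset_leq_card/subsetP=> _ /imsetP[w + ->].
  by rewrite !inE /= eqxx andbT.
by move=> w w' [].
Qed.

End FiniteImages.

(** * Rooted spanning trees and products along their edges *)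

Section SpanningTrees.

Local Open Scope ring_scope.

(** The pairs [v], [par v] with [v != r] are the edges of a breadth-first spanning tree; [depth] is
    the distance from [r] and supports induction. *)
Lemma bfs_parent (T : finType) (e : rel T) (r : T) :
    symmetric e -> (forall v, connect e r v) ->
  exists (par : T -> T) (depth : T -> nat),
    forall v, v != r -> e v (par v) /\ depth v = (depth (par v)).+1.
Proof.
move=> e_sym e_conn.
pose walk v m := [exists p : m.-tuple T, path e r p && (last r p == v)].
have walkP v m :
    reflect (exists p, [/\ path e r p, last r p = v & size p = m]) (walk v m).
  apply: (iffP existsP) => [[p /andP[ep /eqP lp]] | [p [ep lp /eqP sp]]].
    by exists p; rewrite size_tuple.
  by exists (Tuple sp); rewrite /= ep lp eqxx.
have walk_ex v : exists m, walk v m.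
  by have /connectP[p ep lp] := e_conn v; exists (size p); apply/walkP; exists p.
pose depth v := ex_minn (walk_ex v).
have /fin_all_exists[par parP] v :
    exists u, v != r -> e v u /\ depth v = (depth u).+1.
  have [-> | vr] := eqVneq v r; first by exists r.
  (* The parent is the last vertex before [v] on a shortest walk; that walk is nonempty because
     [v != r]. *)
  rewrite {1}/depth; case: ex_minnP => m /walkP[p [ep lp sp]] m_min.
  case: (lastP p) ep lp sp vr => [_ <- _ /eqP // | p' w].
  rewrite rcons_path last_rcons size_rcons => /andP[ep ew] wv sp _.
  rewrite -{}wv in m_min *; exists (last r p') => _; split; first by rewrite e_sym.
  rewrite /depth; case: ex_minnP => m' /walkP[q [eq lq sq]] m'_min.
  (* Extending a shortest walk to the parent by [w] gives one inequality; cutting [w] off gives the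
     other. *)
  apply/eqP; rewrite eqn_leq; apply/andP; split.
    apply: m_min; apply/walkP; exists (rcons q w).
    by rewrite rcons_path last_rcons size_rcons eq lq ew sq.
  by rewrite -sp ltnS; apply: m'_min; apply/walkP; exists p'.
by exists par, depth.
Qed.

Variables (K : fieldType) (T : finType) (r : T) (par : T -> T) (depth : T -> nat).
Hypothesis depth_par : forall v, v != r -> depth v = (depth (par v)).+1.

Lemma tree_edge_values_surj (t : T -> K) : (forall v, t v != 0) ->
  exists2 x : T -> K, forall v, x v != 0 &
    forall v, v != r -> x v * x (par v) = t v.
Proof.
move=> t0.
(* Solve outwards from the value 1 at the root. The fuel [m] starts at [depth v] and drops with the
   depth, so it does not run out before the root. *)
pose fix sol (m : nat) (v : T) {struct m} : K := if v == r then 1 else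
  if m is m'.+1 then t v / sol m' (par v) else 1.
have sol0 m v : sol m v != 0.
  elim: m v => [|m IHm] v /=; case: ifP; rewrite ?oner_eq0 //.
  by rewrite mulf_neq0 ?invr_eq0.
exists (fun v => sol (depth v) v) => // v vr.
by rewrite (depth_par vr) /= (negPf vr) divfK.
Qed.

(* The ratio x / y alternates between two values along the tree. *)
Lemma tree_edge_values_rigid (x y : T -> K) (c : K) (side : pred T) :
    (forall v, x v != 0) -> (forall v, y v != 0) -> c != 0 ->
    (forall v, v != r -> side (par v) = ~~ side v) ->
    (forall v, v != r -> x v * x (par v) = c * (y v * y (par v))) ->
  exists a b, [/\ a != 0, b != 0, a * b = c &
    forall v, x v = (if side v then a else b) * y v].
Proof.
move=> x0 y0 c0 side_par xy; pose rho := x r / y r.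
have rho0 : rho != 0 by rewrite mulf_neq0 ?invr_eq0.
(* The ratios at the two ends of a tree edge multiply to [c]: the side of the root gets [rho], the
   other side [c / rho]. *)
pose a := if side r then rho else c / rho.
pose b := if side r then c / rho else rho.
have a0 : a != 0 by rewrite /a; case: ifP; rewrite ?mulf_neq0 ?invr_eq0.
have b0 : b != 0 by rewrite /b; case: ifP; rewrite ?mulf_neq0 ?invr_eq0.
have ab : a * b = c by rewrite /a /b; case: ifP; rewrite ?divfK // mulrC divfK.
exists a, b; split=> // v; have [m] := ubnP (depth v).
elim: m v => // m IHm v; rewrite ltnS => vm.
have [-> | vr] := eqVneq v r.
  by rewrite /a /b /rho; case: (side r); rewrite divfK.
have := IHm (par v); rewrite -(depth_par vr) => /(_ vm) xp.
apply: (mulIf (x0 (par v))); rewrite (xy v vr) xp (side_par v vr) -ab.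
by rewrite [RHS]mulrACA; case: (side v); rewrite /= 1?[a * b]mulrC.
Qed.

End SpanningTrees.

(** * Edge monomials and bipartitions *)

Section BipartiteEdges.

Local Open Scope ring_scope.

Lemma monomial_pair (K : finFieldType) n (j k : 'I_n) (x : 'rV[K]_n) :
  j != k -> monomial (char_vector [set j; k]) x = x ord0 j * x ord0 k.
Proof.
move=> jk; rewrite /monomial (bigD1 j) //= (bigD1 k) ?(eq_sym k) //=.
rewrite !mxE !inE !eqxx orbT /= !expr1 big1 ?mulr1 // => i /andP[ij ik].
by rewrite mxE !inE (negPf ij) (negPf ik) expr0.
Qed.

Lemma bipartition_setC n (e : rel 'I_n) (V1 V2 : {set 'I_n}) :
  bipartition e V1 V2 -> V2 = ~: V1.
Proof.
case=> VT V12 _; apply/setP=> v; rewrite inE.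
have := in_setT v; rewrite -VT inE.
by case: (boolP (v \in V1)) => //= /(disjointFr V12).
Qed.

End BipartiteEdges.

(** * Parameterized codes and pullbacks of forms *)

Section ParameterizedCodes.

Import Order.Theory.
Local Open Scope ring_scope.

Variable K : finFieldType.

(** Pullback along a monomial map. With [c] equal to 1 it serves the coordinate projection of the
    upper bound; with [c] read off a fixed point it gives the partial forms of the lower bound. *)
Definition substX N M (h : 'I_M -> 'I_N) (c : 'I_M -> K) (p : {mpoly K[M]}) :
    {mpoly K[N]} :=
  p \mPo [tuple c i *: 'X_(h i) | i < M].

Lemma meval_substX N M (h : 'I_M -> 'I_N) c (p : {mpoly K[M]}) (v : 'I_N -> K) :
  (substX h c p).@[v] = p.@[fun i => c i * v (h i)].
Proof.
rewrite /substX comp_mpoly_meval; apply: meval_eq => i.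
by rewrite tnth_mktuple mevalZ mevalXU.
Qed.

Lemma dhomog_substX N M (h : 'I_M -> 'I_N) c d (p : {mpoly K[M]}) :
  p \is d.-homog -> substX h c p \is d.-homog.
Proof.
move=> /dhomogP hp; rewrite /substX comp_mpolyE big_seq.
apply: rpred_sum => m /hp /= <-; apply: rpredZ.
rewrite (mdegE m); elim/big_rec2: _ => [|i q e _ hq]; first exact: dhomog1.
apply: dhomogM hq; rewrite tnth_mktuple -[X in X.-homog]mul1n.
by apply: dhomogMn; apply: rpredZ; rewrite dhomogX; apply/eqP; exact: mdeg1.
Qed.

Section Weights.

Variables (N d : nat) (T : finType) (A : {set T}) (phi : T -> 'rV[K]_N.+1).
Hypothesis phi_neq0 : forall t, t \in A -> phi t ord0 ord0 != 0.

Local Notation Z := [set ppoint (phi t) | t in A].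

(** Points are collected rather than parameters, since [phi] may reach the same point many times. *)
Definition nonzero_points (p : {mpoly K[N.+1]}) :=
  [set ppoint (phi t) | t in A & p.@[phi t ord0] != 0].

Lemma normalized_eval_prep (p : dhomog N.+1 K d) t : t \in A ->
  (normalized_eval d p (prep (ppoint (phi t))) != 0) = (p.@[phi t ord0] != 0).
Proof.
move=> tA; have [c c0 ->] := prep_ppoint (phi t).
rewrite normalized_evalZ ?dhomog_is_dhomog // /normalized_eval.
rewrite mulf_eq0 invr_eq0 rmorphXn /= mevalXU expf_eq0.
by rewrite (negPf (phi_neq0 tA)) andbF orbF.
Qed.

Lemma hweight_codeword (p : dhomog N.+1 K d) :
  hweight (codeword Z p) = #|nonzero_points p|.
Proof.
rewrite /hweight -(card_imset _ enum_val_inj); congr #|pred_of_set _|.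
apply/setP=> P; apply/imsetP/imsetP.
  case=> i; rewrite inE mxE => hi ->; have /imsetP[t tA eP] := enum_valP i.
  by exists t => //; rewrite inE tA; move: hi; rewrite eP normalized_eval_prep.
case=> t; rewrite inE => /andP[tA pt] ->.
have Pt : ppoint (phi t) \in Z by apply: imset_f.
exists (enum_rank_in Pt (ppoint (phi t))); rewrite ?enum_rankK_in //.
by rewrite inE mxE enum_rankK_in // normalized_eval_prep.
Qed.

Lemma codeword_eq0 (p : dhomog N.+1 K d) :
  (codeword Z p == 0) = [forall t in A, p.@[phi t ord0] == 0].
Proof.
apply/eqP/forall_inP => [p0 t tA | p0].
  apply: contraTT (eqxx #|nonzero_points p|) => pt.
  rewrite -{1}hweight_codeword p0 /hweight.
  rewrite (_ : [set i | _] = set0) ?cards0; last first.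
    by apply/setP=> i; rewrite !inE mxE eqxx.
  rewrite eq_sym -lt0n; apply/card_gt0P; exists (ppoint (phi t)).
  by apply: imset_f; rewrite inE tA.
apply/rowP=> i; rewrite mxE [RHS]mxE; apply/eqP.
have /imsetP[t tA ->] := enum_valP i.
by rewrite -[_ == _]negbK normalized_eval_prep // negbK p0.
Qed.

Lemma min_distance_le (p : dhomog N.+1 K d) t :
  t \in A -> p.@[phi t ord0] != 0 -> (min_distance Z d <= #|nonzero_points p|)%N.
Proof.
move=> tA pt; rewrite -hweight_codeword /min_distance -minEnat -leEnat.
apply: bigmin_le_cond; rewrite codeword_eq0 -[codeword Z p]lfunE memv_img ?memvf //.
by apply/forall_inPn; exists t.
Qed.

Lemma leq_min_distance m t0 : t0 \in A ->
    (forall (p : dhomog N.+1 K d) t, t \in A -> p.@[phi t ord0] != 0 ->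
       (m <= #|nonzero_points p|)%N) ->
  (m <= min_distance Z d)%N.
Proof.
move=> t0A hm; rewrite /min_distance -minEnat -leEnat; apply/bigmin_geP; split.
  (* The default value [#|Z|] of the minimum must be bounded too: the nonzeros of [t_1^d] number at
     least [m] and lie in [Z]. *)
  have hX : ('X_ord0 ^+ d : {mpoly K[N.+1]}) \is d.-homog.
    by rewrite -[d in d.-homog]mul1n dhomogMn // dhomogX; apply/eqP; exact: mdeg1.
  apply: leq_trans (hm (DHomog hX) t0 t0A _) _.
    by rewrite /= rmorphXn /= mevalXU expf_neq0 ?phi_neq0.
  apply/subset_leq_card/subsetP=> _ /imsetP[t + ->]; rewrite inE => /andP[tA _].
  exact: imset_f.
move=> v /andP[/memv_imgP[p _ ->]]; rewrite lfunE /= codeword_eq0.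
by case/forall_inPn=> t tA pt; rewrite hweight_codeword; apply: (hm p t).
Qed.

End Weights.

Lemma eq_ppoint N (v w : 'rV[K]_N.+1) :
  ppoint v = ppoint w -> exists2 c, c != 0 & v = c *: w.
Proof.
move=> vw; have: v \in ppoint v.
  by apply/imsetP; exists 1; rewrite ?inE ?oner_eq0 ?scale1r.
by rewrite vw => /imsetP[c]; rewrite inE => c0 ->; exists c.
Qed.

Lemma ppointZ N (v : 'rV[K]_N.+1) c : c != 0 -> ppoint (c *: v) = ppoint v.
Proof.
move=> c0; apply/setP=> w; apply/imsetP/imsetP=> -[a]; rewrite inE => a0 ->.
  by exists (a * c); rewrite ?scalerA // inE mulf_neq0.
by exists (a / c); rewrite ?inE ?mulf_neq0 ?invr_eq0 // scalerA divfK.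
Qed.

Lemma affine_torusP n (x : 'rV[K]_n) :
  reflect (forall i, x ord0 i != 0) (x \in affine_torus K n).
Proof. by rewrite inE; exact: forallP. Qed.

Definition coord_row n M (g : 'I_M -> 'I_n) (x : 'rV[K]_n) : 'rV[K]_M :=
  \row_i x ord0 (g i).

(** Disjoint blocks of coordinates can be filled independently; the remaining coordinates are set to
    1 to stay in the torus. *)
Lemma coord_row_lift2 n N1 N2 (g1 : 'I_N1 -> 'I_n) (g2 : 'I_N2 -> 'I_n)
    (y : 'rV[K]_N1) (z : 'rV[K]_N2) :
    injective g1 -> injective g2 -> (forall a b, g1 a != g2 b) ->
    y \in affine_torus K N1 -> z \in affine_torus K N2 ->
  exists2 x, x \in affine_torus K n & coord_row g1 x = y /\ coord_row g2 x = z.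
Proof.
move=> g1I g2I g12 /affine_torusP y0 /affine_torusP z0.
exists (\row_v if [pick a | g1 a == v] is Some a then y ord0 a
          else if [pick b | g2 b == v] is Some b then z ord0 b else 1).
  apply/affine_torusP=> v; rewrite mxE; case: pickP => // _.
  by case: pickP => // _; apply: oner_neq0.
split; apply/rowP=> i; rewrite !mxE.
  by case: pickP => [a /eqP/g1I-> // | /(_ i)]; rewrite eqxx.
case: pickP => [a | _]; first by rewrite (negPf (g12 _ _)).
by case: pickP => [a /eqP/g2I-> // | /(_ i)]; rewrite eqxx.
Qed.

Lemma const_mx1_torus n : const_mx 1 \in affine_torus K n.
Proof. by apply/affine_torusP=> i; rewrite mxE oner_neq0. Qed.

Lemma torus_neq0 N (x : 'rV[K]_N.+1) :
  x \in affine_torus K N.+1 -> x ord0 ord0 != 0.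
Proof. by move/affine_torusP. Qed.

(** * Comparison of toric sets with projective tori *)

Section ToricComparison.

Variables (n s d : nat) (phi : 'rV[K]_n -> 'rV[K]_s.+1).
Hypothesis phi_torus : forall x, x \in affine_torus K n ->
  phi x \in affine_torus K s.+1.

Local Notation Z := [set ppoint (phi x) | x in affine_torus K n].

(** The two hypotheses say that the coordinates [h] cover the torus and separate the points of [Z].
    A form on the torus thus pulls back to a form that is nonzero on [Z] and has no more
    nonzeros. *)
Lemma min_distance_le_torus M (h : 'I_M.+1 -> 'I_s.+1) :
    (forall y, y \in affine_torus K M.+1 ->
       exists2 x, x \in affine_torus K n & coord_row h (phi x) = y) ->
    {in affine_torus K n &, forall x y,
       ppoint (coord_row h (phi x)) = ppoint (coord_row h (phi y)) ->
       ppoint (phi x) = ppoint (phi y)} ->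
  (min_distance Z d <= min_distance (projective_torus K M) d)%N.
Proof.
move=> surj sep; apply: (leq_min_distance (@torus_neq0 M) (const_mx1_torus _)).
move=> p _ /surj[x xT <-] px.
have pE z : (substX h (fun=> 1) p).@[phi z ord0] = p.@[coord_row h (phi z) ord0].
  by rewrite meval_substX; apply: meval_eq => i; rewrite mxE mul1r.
pose q := DHomog (dhomog_substX h (fun=> 1) (dhomog_is_dhomog p)).
apply: leq_trans (@min_distance_le _ d _ _ _ _ q x xT _) _.
- by move=> z /phi_torus/torus_neq0.
- by rewrite /= pE.
pose B := [set z in affine_torus K n | p.@[coord_row h (phi z) ord0] != 0].
apply: (@leq_trans #|[set ppoint (coord_row h (phi z)) | z in B]|).
  rewrite /nonzero_points (_ : [set t in _ | _] = B); last first.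
    by apply/setP=> z; rewrite !inE pE.
  apply: leq_card_imset_ker => y z; rewrite !inE => /andP[yT _] /andP[zT _].
  by apply: sep; rewrite inE.
apply/subset_leq_card/subsetP=> _ /imsetP[z + ->]; rewrite inE => /andP[zT pz].
apply: imset_f; rewrite inE pz andbT; apply/affine_torusP=> i.
by rewrite mxE; have /affine_torusP := phi_torus zT.
Qed.

Lemma torus_min_distance_mul N1 N2 (g1 : 'I_N1.+1 -> 'I_n)
    (g2 : 'I_N2.+1 -> 'I_n) (j : 'I_s.+1 -> 'I_N1.+1) (k : 'I_s.+1 -> 'I_N2.+1) :
    injective g1 -> injective g2 -> (forall a b, g1 a != g2 b) ->
    (forall x i, phi x ord0 i = x ord0 (g1 (j i)) * x ord0 (g2 (k i))) ->
    {in affine_torus K n &, forall x y, ppoint (phi x) = ppoint (phi y) ->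
       ppoint (coord_row g1 x) = ppoint (coord_row g1 y) /\
       ppoint (coord_row g2 x) = ppoint (coord_row g2 y)} ->
  (min_distance (projective_torus K N1) d * min_distance (projective_torus K N2) d
     <= min_distance Z d)%N.
Proof.
move=> g1I g2I g12 phiE sep.
have phi0 x : x \in affine_torus K n -> phi x ord0 ord0 != 0.
  by move/phi_torus/torus_neq0.
apply: (leq_min_distance phi0 (const_mx1_torus _)) => p x0 x0T px0.
pose B := [set x in affine_torus K n | p.@[phi x ord0] != 0].
pose S := [set (ppoint (coord_row g1 x), ppoint (coord_row g2 x)) | x in B].
(* By [sep], [ppoint (phi x)] determines the pair, so there are at most as many pairs as
   nonzeros. *)
apply: (@leq_trans #|S|); last first.
  apply: leq_card_imset_ker => x y; rewrite !inE => /andP[xT _] /andP[yT _].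
  by case/sep=> [||-> ->]; rewrite ?inE.
(* The form F(., y0), with y0 the second block of [x0]. *)
pose p1 := DHomog (dhomog_substX j (fun i => x0 ord0 (g2 (k i)))
                     (dhomog_is_dhomog p)).
have rT N (g : 'I_N.+1 -> 'I_n) x : x \in affine_torus K n ->
    coord_row g x \in affine_torus K N.+1.
  by move/affine_torusP=> x_neq0; apply/affine_torusP=> i; rewrite mxE.
have p1x0 : p1.@[coord_row g1 x0 ord0] != 0.
  rewrite /= meval_substX; apply: contraNneq px0 => <-; apply/eqP.
  by apply: meval_eq => i; rewrite mxE phiE mulrC.
apply: leq_trans (leq_mul
  (min_distance_le (@torus_neq0 N1) (rT _ g1 _ x0T) p1x0) (leqnn _)) _.
apply: leq_card_pair_fibers => _ /imsetP[y + ->]; rewrite inE => /andP[yT p1y].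
(* The form F(y, .). At the second block of [x0] it takes the value of [p1] at [y], hence is
   nonzero. *)
pose p2 := DHomog (dhomog_substX k (fun i => y ord0 (j i)) (dhomog_is_dhomog p)).
have p2E z : p2.@[z ord0] = p.@[fun i => y ord0 (j i) * z ord0 (k i)].
  by rewrite /= meval_substX.
have p2x0 : p2.@[coord_row g2 x0 ord0] != 0.
  rewrite p2E; apply: contraNneq p1y => <-; apply/eqP.
  by rewrite /= meval_substX; apply: meval_eq => i; rewrite mxE mulrC.
apply: leq_trans (min_distance_le (@torus_neq0 N2) (rT _ g2 _ x0T) p2x0) _.
apply/subset_leq_card/subsetP=> _ /imsetP[z + ->]; rewrite inE => /andP[zT p2z].
(* Glue [y] and [z] into one torus point, so that the pair of their classes lies in [S]. *)
have [x xT [xy xz]] := coord_row_lift2 g1I g2I g12 yT zT.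
rewrite inE; apply/imsetP; exists x; rewrite ?xy ?xz // inE xT.
apply: contraNneq p2z => <-; rewrite p2E; apply/eqP.
by apply: meval_eq => i; rewrite phiE -xy -xz !mxE.
Qed.

End ToricComparison.

End ParameterizedCodes.

(** * Toric sets of connected bipartite graphs *)

Theorem theorem3p6 (K : finFieldType) (hK : #|K| <> 2)
  (n : nat) (e : rel 'I_n) (e_sym : symmetric e) (e_irr : irreflexive e)
  (e_conn : forall j k, connect e j k)
  (s : nat) (f : 'I_s.+1 -> {set 'I_n}) (f_inj : injective f)
  (f_edges : [set f i | i : 'I_s.+1] = graph_edges e)
  (V1 V2 : {set 'I_n}) (hV : bipartition e V1 V2)
  (d : nat) (hd : 1 <= d) :
  let X := edge_toric_set K f in
  let X1 := projective_torus K (#|V1| - 1) in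
  let X2 := projective_torus K (#|V2| - 1) in
  let X3 := projective_torus K (#|V1| + #|V2| - 2) in
  min_distance X1 d * min_distance X2 d <= min_distance X d
    /\ min_distance X d <= min_distance X3 d.
Proof.
have V2C := bipartition_setC hV; have [_ _ V12e] := hV.
have e_side u v : e u v -> (v \in V1) = (u \notin V1).
  by move/V12e; rewrite V2C !inE; case: (u \in V1); case: (v \in V1).
have f_ends i : exists uv : 'I_n * 'I_n,
    [/\ e uv.1 uv.2, uv.1 \in V1, uv.2 \in V2 & f i = [set uv.1; uv.2]].
  have: f i \in graph_edges e by rewrite -f_edges imset_f.
  case/imsetP=> -[u v]; rewrite inE /= => euv ->.
  have vu := e_side _ _ euv; have [u1 | u2] := boolP (u \in V1).
    by exists (u, v); rewrite V2C inE vu u1.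
  by exists (v, u); rewrite V2C inE vu u2 e_sym setUC.
have edge_index u v : e u v -> exists i, f i = [set u; v].
  move=> euv; have: [set u; v] \in graph_edges e.
    by apply/imsetP; exists (u, v); rewrite ?inE.
  by rewrite -f_edges => /imsetP[i _ ->]; exists i.
(* One edge supplies the root and shows both sides nonempty, which makes the truncated subtractions
   in the dimensions exact. *)
have [[r r2] [_ /= r_V1 r2_V2 _]] := f_ends ord0.
have V1_gt0 : 0 < #|V1| by apply/card_gt0P; exists r.
have V2_gt0 : 0 < #|V2| by apply/card_gt0P; exists r2.
have [par [depth parP]] := bfs_parent e_sym (e_conn r).
have depth_par v : v != r -> depth v = (depth (par v)).+1 by case/parP.
have [g1 g1I g1P] : exists2 g : 'I_(#|V1| - 1).+1 -> 'I_n, injective g &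
    forall v, v \in V1 <-> exists i, v = g i.
  by apply: card_enum_inj; rewrite subn1 prednK.
have [g2 g2I g2P] : exists2 g : 'I_(#|V2| - 1).+1 -> 'I_n, injective g &
    forall v, v \in V2 <-> exists i, v = g i.
  by apply: card_enum_inj; rewrite subn1 prednK.
(* Each non-root vertex stands for the tree edge to its parent, whence |V1| + |V2| - 1
   coordinates. *)
have [g3 g3I g3P] : exists2 g : 'I_(#|V1| + #|V2| - 2).+1 -> 'I_n, injective g &
    forall v, v \in [set~ r] <-> exists i, v = g i.
  apply: card_enum_inj; rewrite cardsC1 card_ord.
  have nE : #|V1| + #|V2| = n by rewrite V2C cardsC card_ord.
  rewrite -[X in X.-1 = _]nE.
  by case: #|V1| #|V2| V1_gt0 V2_gt0 => [|a] [|b] // _ _; rewrite addSn addnS subn2.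
have /fin_all_exists[j /fin_all_exists[k jkP]] i : exists a b,
    f i = [set g1 a; g2 b].
  have [[u v] /= [_ /g1P[a ->] /g2P[b ->] ->]] := f_ends i.
  by exists a, b.
have /fin_all_exists[h hP] i : exists l, f l = [set g3 i; par (g3 i)].
  have: g3 i \in [set~ r] by apply/g3P; exists i.
  by rewrite !inE => /parP[/edge_index].
have g12 a b : g1 a != g2 b.
  have: g1 a \in V1 by apply/g1P; exists a.
  by apply: contraTneq => ->; rewrite -in_setC -V2C; apply/g2P; exists b.
pose phi (x : 'rV[K]_n) := (\row_i monomial (char_vector (f i)) x)%R.
have phi_edge u v i x : e u v -> f i = [set u; v] ->
    phi x ord0 i = (x ord0 u * x ord0 v)%R.
  move=> euv fi; rewrite mxE fi monomial_pair //.
  by apply: contraTneq euv => ->; rewrite e_irr.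
have phiE x i : phi x ord0 i = (x ord0 (g1 (j i)) * x ord0 (g2 (k i)))%R.
  by rewrite mxE jkP monomial_pair.
have treeE x i :
    coord_row h (phi x) ord0 i = (x ord0 (g3 i) * x ord0 (par (g3 i)))%R.
  rewrite mxE (phi_edge _ _ _ _ _ (hP i)) //.
  have: g3 i \in [set~ r] by apply/g3P; exists i.
  by rewrite !inE => /parP[].
have phi_torus x : x \in affine_torus K n -> phi x \in affine_torus K s.+1.
  move/affine_torusP=> x0; apply/affine_torusP=> i.
  by rewrite phiE mulf_neq0.
(* Proportionality on tree edges alone already forces proportionality on each side; both bounds use
   this. *)
have rigid x y c : x \in affine_torus K n -> y \in affine_torus K n -> c != 0%R ->
    (forall v, v != r -> x ord0 v * x ord0 (par v) =
                         c * (y ord0 v * y ord0 (par v)))%R ->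
    exists a b, [/\ a != 0, b != 0, a * b = c,
      coord_row g1 x = a *: coord_row g1 y &
      coord_row g2 x = b *: coord_row g2 y]%R.
  move=> /affine_torusP x0 /affine_torusP y0 c0 xy.
  have side v : v != r -> (par v \in V1) = (v \notin V1).
    by case/parP=> /e_side.
  have [a [b [a0 b0 ab xE]]] := tree_edge_values_rigid depth_par x0 y0 c0 side xy.
  exists a, b; split=> //; apply/rowP=> i; rewrite !mxE xE.
    by case: ifPn => // /negP[]; apply/g1P; exists i.
  case: ifPn => // g2_V1; have: g2 i \in V2 by apply/g2P; exists i.
  by rewrite V2C inE => /negP[].
split.
  apply: (torus_min_distance_mul d phi_torus g1I g2I g12 phiE) => x y xT yT.
  case/eq_ppoint=> c c0 /rowP xy.
  have [|a [b [a0 b0 _ -> ->]]] := rigid x y c xT yT c0; last by rewrite !ppointZ.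
  move=> v /parP[ev _]; have [i fi] := edge_index _ _ ev.
  by have := xy i; rewrite [in RHS]mxE !(phi_edge _ _ _ _ ev fi).
apply: (min_distance_le_torus d phi_torus (h := h)) => [y yT | x y xT yT].
  (* The root forms a second block with value 1, extending the prescribed tree-edge values [y] to a
     nonvanishing function on all vertices. *)
  have r_inj : injective (fun _ : 'I_1 => r) by move=> a b _; rewrite !ord1.
  have g3r a (b : 'I_1) : g3 a != r.
    by have: g3 a \in [set~ r]; [apply/g3P; exists a | rewrite !inE].
  have [t /affine_torusP t0 [<- _]] :=
    coord_row_lift2 g3I r_inj g3r yT (const_mx1_torus K 1).
  have [x x0 xE] := tree_edge_values_surj depth_par t0.
  exists (\row_v x v)%R; first by apply/affine_torusP=> v; rewrite mxE.
  by apply/rowP=> i; rewrite treeE !mxE xE // (g3r i ord0).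
case/eq_ppoint=> c c0 /rowP xy.
have [v vr | a [b [_ _ ab x1 x2]]] := rigid x y c xT yT c0.
  have /g3P[i ->] : v \in [set~ r] by rewrite !inE.
  by have := xy i; rewrite [in RHS]mxE !treeE.
(* Every edge, in the tree or not, has one end on each side, so its coordinate scales by
   [a * b = c]. *)
suff -> : phi x = (c *: phi y)%R by rewrite ppointZ.
apply/rowP=> i; rewrite [RHS]mxE !phiE.
have /rowP/(_ (j i)) := x1; have /rowP/(_ (k i)) := x2; rewrite !mxE => -> ->.
by rewrite -ab mulrACA.
Qed.
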